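(* Let $M\in\mathbb{C}^{n\times n}$ be unitary, let $\mathcal{X},\mathcal{Y}\in\mathbb{C}^{m\times p\times n}$, and set $X=\mathsf{unfold}(\mathcal{X})$, $Y=\mathsf{unfold}(\mathcal{Y})\in\mathbb{C}^{mn\times p}$. Then for every $\mathcal{A}\in\mathbb{C}^{m\times m\times n}$, $$\|\mathcal{Y}-\mathcal{A}\star_M\mathcal{X}\|_F^2=\left\|Y-(M^*\otimes I)\,\mathsf{bdiag}(\mathcal{A}\times_3M)\,(M\otimes I)X\right\|_F^2 .$$ Consequently the tensor regression problem $\min_{\mathcal{A}\in\mathbb{C}^{m\times m\times n}}\|\mathcal{Y}-\mathcal{A}\star_M\mathcal{X}\|_F^2$ can be rewritten as the constrained matrix least-squares problem $$\min_{A\in\mathbb{A}_M^{m\times m}}\|Y-AX\|_F^2,$$ and the optimal solution is $$A_{\rm StarMDMD}=(M^*\otimes I)\,\mathsf{bdiag}(\mathcal{A}_{\rm StarMDMD}\times_3M)\,(M\otimes I),\qquad \mathcal{A}_{\rm StarMDMD}=\mathcal{Y}\star_M\mathcal{X}^\dagger .$$ Here $I$ is the $m\times m$ identity matrix.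
   Context: Tensors are third-order arrays; $\mathcal{X}(:,:,j)$ is the $j$-th frontal slice of $\mathcal{X}\in\mathbb{C}^{m\times p\times n}$, and $\|\cdot\|_F^2$ is the sum of squared moduli of the entries. For $B\in\mathbb{C}^{q\times n}$, the mode-3 product $\mathcal{X}\times_3B\in\mathbb{C}^{m\times p\times q}$ has entries $(\mathcal{X}\times_3B)_{ijl}=\sum_{k=1}^nB_{lk}\mathcal{X}_{ijk}$. For unitary $M\in\mathbb{C}^{n\times n}$ write $\widehat{\mathcal{X}}=\mathcal{X}\times_3M$, so $\mathcal{X}=\widehat{\mathcal{X}}\times_3M^*$. The $\star_M$-product of $\mathcal{A}\in\mathbb{C}^{m\times p\times n}$ and $\mathcal{B}\in\mathbb{C}^{p\times s\times n}$ is the tensor $\mathcal{C}\in\mathbb{C}^{m\times s\times n}$ with $\widehat{\mathcal{C}}(:,:,j)=\widehat{\mathcal{A}}(:,:,j)\widehat{\mathcal{B}}(:,:,j)$ for all $j$. The pseudoinverse $\mathcal{X}^\dagger\in\mathbb{C}^{p\times m\times n}$ is the tensor with $\widehat{\mathcal{X}^\dagger}(:,:,j)=\widehat{\mathcal{X}}(:,:,j)^\dagger$ (Moore-Penrose inverse) for all $j$. $\mathsf{unfold}(\mathcal{X})\in\mathbb{C}^{mn\times p}$ is the matrix obtained by stacking the frontal slices $\mathcal{X}(:,:,1),\dots,\mathcal{X}(:,:,n)$ vertically, in this order. $\mathsf{bdiag}(\mathcal{X})\in\mathbb{C}^{mn\times pn}$ is the block diagonal matrix with diagonal blocks $\mathcal{X}(:,:,1),\dots,\mathcal{X}(:,:,n)$.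 $\otimes$ is the Kronecker product. $\mathbb{A}_M^{m\times m}=\{(M^*\otimes I)\,\mathsf{bdiag}(\mathcal{Z}\times_3M)\,(M\otimes I):\mathcal{Z}\in\mathbb{C}^{m\times m\times n}\}\subset\mathbb{C}^{mn\times mn}$, with $I$ the $m\times m$ identity. *)

(* Defs.v *)
From mathcomp Require Import all_boot all_order all_algebra.
From mathcomp Require Import spectral.
From mathcomp Require Import boolp classical_sets reals.
From mathcomp.real_closed Require Import complex.
From mathcomp.real_closed Require mxtens.

Set Implicit Arguments.
Unset Strict Implicit.
Unset Printing Implicit Defensive.

Import Order.TTheory GRing.Theory Num.Theory.
Export mxtens(mxtens_index, mxtens_unindex, tensmx).

Local Open Scope ring_scope.
Local Open Scope sesquilinear_scope.
Local Open Scope classical_set_scope.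

Section MoorePenrose.
Variable C : numClosedFieldType.

Definition penrose (m p : nat) (A : 'M[C]_(m, p)) (B : 'M[C]_(p, m)) : bool :=
  [&& A *m B *m A == A, B *m A *m B == B,
      (A *m B)^t* == A *m B & (B *m A)^t* == B *m A].

Lemma trmxC_mul (m n p : nat) (A : 'M[C]_(m, n)) (B : 'M[C]_(n, p)) :
  (A *m B)^t* = B^t* *m A^t*.
Proof. by rewrite trmx_mul map_mxM. Qed.

Lemma row_free_gram (r p : nat) (G : 'M[C]_(r, p)) :
  row_free G -> G *m G^t* \in unitmx.
Proof.
move=> Gfree; rewrite -row_free_unit -kermx_eq0.
apply/eqP/row_matrixP => i; rewrite row0.
set u := row i _.
have u0 : u *m (G *m G^t*) = 0.
  by apply/sub_kermxP; apply: row_sub.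
have /eqP : dotmx (u *m G) (u *m G) = 0.
  by rewrite dotmxE trmxC_mul !mulmxA -(mulmxA u) u0 mul0mx mxE.
rewrite dnorm_eq0 => /eqP uG0.
by apply: (row_free_inj Gfree); rewrite uG0 mul0mx.
Qed.

Lemma penrose_factor (m r p : nat) (F : 'M[C]_(m, r)) (G : 'M[C]_(r, p)) :
  F^t* *m F \in unitmx -> G *m G^t* \in unitmx ->
  penrose (F *m G)
    (G^t* *m invmx (G *m G^t*) *m invmx (F^t* *m F) *m F^t*).
Proof.
move=> FU GU; set P := invmx (G *m _); set Q := invmx _.
have hermV (S : 'M[C]_r) : S^t* = S -> (invmx S)^t* = invmx S.
  by move=> SE; rewrite trmx_inv map_invmx SE.
have Ph : P^t* = P by apply: hermV; rewrite trmxC_mul trmxCK.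
have Qh : Q^t* = Q by apply: hermV; rewrite trmxC_mul trmxCK.
set B := _ *m F^t*.
have ABE : F *m G *m B = F *m Q *m F^t*.
  by rewrite /B !mulmxA -(mulmxA F G) -(mulmxA F _ P) mulmxV // mulmx1.
have BAE : B *m (F *m G) = G^t* *m P *m G.
  rewrite /B !mulmxA -(mulmxA (G^t* *m P *m Q) _ F).
  by rewrite -(mulmxA (G^t* *m P) Q) mulVmx // mulmx1.
apply/and4P; split; apply/eqP.
- rewrite ABE !mulmxA -(mulmxA (F *m Q) _ F) -(mulmxA F Q).
  by rewrite mulVmx // mulmx1.
- rewrite BAE /B !mulmxA -(mulmxA (G^t* *m P) G) -(mulmxA (G^t* *m P) _ P).
  by rewrite mulmxV // mulmx1.
- by rewrite ABE !trmxC_mul trmxCK Qh !mulmxA.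
- by rewrite BAE !trmxC_mul trmxCK Ph !mulmxA.
Qed.

Lemma penrose_exists (m p : nat) (A : 'M[C]_(m, p)) : exists B, penrose A B.
Proof.
suff : exists B, penrose (col_base A *m row_base A) B by rewrite mulmx_base.
eexists; apply: penrose_factor.
  have := row_free_gram (G := (col_base A)^t* ); rewrite trmxCK; apply.
  by rewrite /row_free mxrank_map mxrank_tr; exact: col_base_full.
by apply: row_free_gram; exact: row_base_free.
Qed.

Lemma penrose_unique (m p : nat) (A : 'M[C]_(m, p)) (B1 B2 : 'M[C]_(p, m)) :
  penrose A B1 -> penrose A B2 -> B1 = B2.
Proof.
case/and4P=> /eqP a1 /eqP b1 /eqP c1 /eqP d1.
case/and4P=> /eqP a2 /eqP b2 /eqP c2 /eqP d2.
have AB : A *m B1 = A *m B2.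
  by rewrite -c1 -{1}a2 -(mulmxA (A *m B2)) trmxC_mul c1 c2 mulmxA a1.
have BA : B1 *m A = B2 *m A.
  by rewrite -d1 -{1}a2 -!mulmxA mulmxA trmxC_mul d1 d2 -mulmxA (mulmxA A) a1.
by rewrite -b1 BA -mulmxA AB mulmxA b2.
Qed.

Definition mp_pinv (m p : nat) (A : 'M[C]_(m, p)) : 'M[C]_(p, m) :=
  xchoose (penrose_exists A).

Lemma mp_pinvP (m p : nat) (A : 'M[C]_(m, p)) : penrose A (mp_pinv A).
Proof. exact: xchooseP. Qed.

End MoorePenrose.

(* X k is the k-th frontal slice, so X k i j is the (i, j, k) entry. *)
Definition tensor (C : Type) (m p n : nat) := {ffun 'I_n -> 'M[C]_(m, p)}.

Section Tensor.
Variable C : numClosedFieldType.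

Definition normF2 (m p : nat) (A : 'M[C]_(m, p)) : C :=
  \sum_i \sum_j `|A i j| ^+ 2.

Definition tnormF2 (m p n : nat) (X : tensor C m p n) : C :=
  \sum_k \sum_i \sum_j `|X k i j| ^+ 2.

Definition mode3 (m p n q : nat) (X : tensor C m p n) (B : 'M[C]_(q, n)) :
    tensor C m p q :=
  [ffun l => \matrix_(i, j) \sum_k B l k * X k i j].

(* starm and tpinv return to the original domain through M^t*; starm_hat and
   tpinv_hat are the slicewise characterizations for unitary M. *)
Definition starm (m p s n : nat) (M : 'M[C]_n)
    (A : tensor C m p n) (B : tensor C p s n) : tensor C m s n :=
  mode3 [ffun j => mode3 A M j *m mode3 B M j] (M ^t* ).

Definition tpinv (m p n : nat) (M : 'M[C]_n) (X : tensor C m p n) :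
    tensor C p m n :=
  mode3 [ffun j => mp_pinv (mode3 X M j)] (M ^t* ).

(* Row mxtens_index (j, i), of value j * m + i, is row i of slice j. *)
Definition unfold (m p n : nat) (X : tensor C m p n) : 'M[C]_(n * m, p) :=
  \matrix_(a, k) X (mxtens_unindex a).1 (mxtens_unindex a).2 k.

Definition bdiag (m p n : nat) (X : tensor C m p n) : 'M[C]_(n * m, n * p) :=
  \matrix_(a, b)
    if (mxtens_unindex a).1 == (mxtens_unindex b).1
    then X (mxtens_unindex a).1 (mxtens_unindex a).2 (mxtens_unindex b).2
    else 0.

Definition starm_mat (m n : nat) (M : 'M[C]_n) (Z : tensor C m m n) :
    'M[C]_(n * m) :=
  tensmx (M ^t* ) (1%:M : 'M[C]_m) *m bdiag (mode3 Z M)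
    *m tensmx M (1%:M : 'M[C]_m).

Definition starm_mats (m n : nat) (M : 'M[C]_n) : set 'M[C]_(n * m) :=
  [set A | exists Z : tensor C m m n, A = starm_mat M Z].

(* The order of C is partial (x <= y iff y - x is a nonnegative real);
   the objectives f minimized below only take real values. *)
Definition argmin (T : Type) (D : set T) (f : T -> C) : set T :=
  [set x | D x /\ forall y, D y -> f x <= f y].

Definition minval (T : Type) (D : set T) (f : T -> C) : set C :=
  [set f x | x in argmin D f].

Lemma mode3M (m p n q r : nat) (X : tensor C m p n)
    (B : 'M[C]_(q, n)) (D : 'M[C]_(r, q)) :
  mode3 (mode3 X B) D = mode3 X (D *m B).
Proof.
apply/ffunP => l; apply/matrixP => i j; rewrite !ffunE !mxE.
under eq_bigr => k _ do rewrite ffunE mxE big_distrr /=.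
rewrite exchange_big; apply: eq_bigr => k _ /=.
by rewrite mxE big_distrl; apply: eq_bigr => h _ /=; rewrite mulrA.
Qed.

Lemma mode3_1 (m p n : nat) (X : tensor C m p n) : mode3 X 1%:M = X.
Proof.
apply/ffunP => l; apply/matrixP => i j; rewrite !ffunE !mxE (bigD1 l) //=.
rewrite mxE eqxx mul1r big1 ?addr0 // => k kl.
by rewrite mxE eq_sym (negPf kl) mul0r.
Qed.

Lemma starm_hat (m p s n : nat) (M : 'M[C]_n)
    (A : tensor C m p n) (B : tensor C p s n) (j : 'I_n) :
  M \is unitarymx ->
  mode3 (starm M A B) M j = mode3 A M j *m mode3 B M j.
Proof. by move=> /unitarymxP MU; rewrite mode3M MU mode3_1 ffunE. Qed.

Lemma tpinv_hat (m p n : nat) (M : 'M[C]_n) (X : tensor C m p n) (j : 'I_n) :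
  M \is unitarymx -> mode3 (tpinv M X) M j = mp_pinv (mode3 X M j).
Proof. by move=> /unitarymxP MU; rewrite mode3M MU mode3_1 ffunE. Qed.

End Tensor.

(* Main.v *)
(** In the transform domain the objective splits into independent matrix
    least-squares problems, one per frontal slice, and each of them is solved
    by [Y_k X_k^+] because the residual [Y_k (1 - X_k^+ X_k)] is orthogonal to
    the row space of [X_k].  The mode-3 product by [B] acts on unfoldings as
    [B (x) I], so it preserves the Frobenius norm when [B] is unitary, and
    the two objectives agree up to the surjection [starm_mat M] onto
    [starm_mats M]. *)
Require Import Defs.
From mathcomp Require Import all_boot all_order all_algebra.
From mathcomp Require Import spectral.
From mathcomp Require Import boolp classical_sets reals.
From mathcomp.real_closed Require Import complex.
From mathcomp.real_closed Require mxtens.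

Import GRing.Theory Num.Theory.

Local Open Scope ring_scope.
Local Open Scope classical_set_scope.

Section Frobenius.
Local Open Scope sesquilinear_scope.
Variable C : numClosedFieldType.

Lemma normF2_ge0 {m p : nat} (A : 'M[C]_(m, p)) : 0 <= normF2 A.
Proof. by do 2![apply: sumr_ge0 => ? _]; rewrite exprn_ge0. Qed.

Lemma normF2_tr {m p : nat} (A : 'M[C]_(m, p)) : normF2 A = \tr (A *m A^t*).
Proof.
apply: eq_bigr => i _; rewrite mxE; apply: eq_bigr => j _.
by rewrite !mxE normCK.
Qed.

(** Pythagoras: the hypothesis makes every row of [U] orthogonal to every row of [V], which kills
    both cross terms of [(U + V) (U + V)^*], the second being the adjoint of the first. *)
Lemma normF2D_orth {m p : nat} (U V : 'M[C]_(m, p)) :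
  U *m V^t* = 0 -> normF2 (U + V) = normF2 U + normF2 V.
Proof.
move=> UV; have VU : V *m U^t* = 0.
  by rewrite -(trmxCK V) -trmxC_mul UV trmx0 map_mx0.
rewrite !normF2_tr linearD /= map_mxD mulmxDl !mulmxDr UV VU addr0 add0r.
by rewrite mxtraceD.
Qed.

Lemma normF2_isometry {m p q : nat} (U : 'M[C]_(q, m)) (A : 'M[C]_(m, p)) :
  U^t* *m U = 1%:M -> normF2 (U *m A) = normF2 A.
Proof.
move=> UU; rewrite !normF2_tr trmxC_mul mulmxA mxtrace_mulC.
by rewrite !mulmxA UU mul1mx.
Qed.

Lemma normF2_mp_pinv {m s p : nat} (Y : 'M[C]_(s, p)) (X : 'M[C]_(m, p))
    (A : 'M[C]_(s, m)) :
  normF2 (Y - Y *m mp_pinv X *m X) <= normF2 (Y - A *m X).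
Proof.
case/and4P: (mp_pinvP X) => /eqP XPX _ _ /eqP Pherm.
(* [X^+ X] is Hermitian, so taking adjoints in [X X^+ X = X] shows that it fixes the columns of
   [X^*]. *)
have PXt : mp_pinv X *m X *m X^t* = X^t*.
  by rewrite -Pherm -trmxC_mul mulmxA XPX.
(* The deviation from the optimal residual has its rows in the row space of [X], so Pythagoras
   applies. *)
have -> : Y - A *m X =
    (Y - Y *m mp_pinv X *m X) + (Y *m mp_pinv X - A) *m X.
  by rewrite mulmxBl addrA subrK.
rewrite [leRHS]normF2D_orth ?lerDl ?normF2_ge0 //.
rewrite trmxC_mul mulmxA mulmxBl -(mulmxA Y) -(mulmxA Y) PXt subrr.
by rewrite mul0mx.
Qed.

Lemma tnormF2_unfold {m p n : nat} (X : tensor C m p n) :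
  tnormF2 X = normF2 (unfold X).
Proof.
rewrite /normF2 /tnormF2 pair_big /=.
rewrite (reindex (fun a : 'I_(n * m) => mxtens_unindex a)) /=.
  by apply: eq_bigr => a _; apply: eq_bigr => j _; rewrite mxE.
exists (@mxtens_index n m) => a _.
  exact: mxtens.mxtens_unindexK.
exact: mxtens.mxtens_indexK.
Qed.

Lemma unfoldB {m p n : nat} (X Y : tensor C m p n) :
  unfold (X - Y) = unfold X - unfold Y.
Proof. by apply/matrixP => a k; rewrite !mxE !ffunE !mxE. Qed.

(** Splits a stacked index into slice and row, so that products with an unfolding can be computed
    blockwise. *)
Lemma sum_mxtens {m n : nat} (F : 'I_(n * m) -> C) :
  \sum_a F a = \sum_j \sum_i F (mxtens_index (j, i)).
Proof.
rewrite pair_big /= (reindex (@mxtens_index n m)) /=.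
  by apply: eq_bigr => -[].
exists (@mxtens_unindex n m) => a _.
  exact: mxtens.mxtens_indexK.
exact: mxtens.mxtens_unindexK.
Qed.

Lemma unfold_mode3 {m p n q : nat} (X : tensor C m p n) (B : 'M[C]_(q, n)) :
  unfold (mode3 X B) = tensmx B 1%:M *m unfold X.
Proof.
apply/matrixP => a k; rewrite !mxE ffunE mxE sum_mxtens.
apply: eq_bigr => j _; rewrite (bigD1 (mxtens_unindex a).2) //= big1.
  by rewrite !mxE mxtens.mxtens_indexK /= eqxx mulr1 addr0.
move=> i ia; rewrite !mxE mxtens.mxtens_indexK /= eq_sym (negPf ia).
by rewrite mulr0 mul0r.
Qed.

Lemma bdiag_unfold {m p s n : nat} (A : tensor C m p n) (X : tensor C p s n) :
  bdiag A *m unfold X = unfold [ffun j => A j *m X j].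
Proof.
apply/matrixP => a k; rewrite !mxE ffunE mxE sum_mxtens.
rewrite (bigD1 (mxtens_unindex a).1) //= [X in _ + X]big1 ?addr0.
  by apply: eq_bigr => i _; rewrite !mxE mxtens.mxtens_indexK eqxx.
move=> j ja; rewrite big1 // => i _.
by rewrite !mxE mxtens.mxtens_indexK eq_sym (negPf ja) mul0r.
Qed.

(** The factors of [starm_mat M A], read from the right, are the three stages of [starm]: transform
    [X], multiply slice by slice, transform back by [M^*]. *)
Lemma unfold_starm {m p n : nat} (M : 'M[C]_n) (A : tensor C m m n)
    (X : tensor C m p n) :
  unfold (starm M A X) = starm_mat M A *m unfold X.
Proof.
by rewrite /starm_mat -!mulmxA -unfold_mode3 bdiag_unfold -unfold_mode3.
Qed.

Lemma tensmx1 {m n : nat} :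
  tensmx (1%:M : 'M[C]_n) (1%:M : 'M[C]_m) = 1%:M.
Proof.
(* A product of two Kronecker deltas is a delta on index pairs, and unindexing is injective. *)
apply/matrixP => a b; rewrite !mxE -natrM mulnb -xpair_eqE -!surjective_pairing.
by rewrite (can_eq (@mxtens.mxtens_unindexK n m)).
Qed.

Lemma tnormF2_mode3 {m p n : nat} (X : tensor C m p n) (M : 'M[C]_n) :
  M \is unitarymx -> tnormF2 (mode3 X M) = tnormF2 X.
Proof.
(* Unitarity reads [M M^* = 1], whereas the isometry lemma wants [M^* M = 1]; the two agree for
   square matrices. *)
move=> /unitarymxP /mulmx1C MM.
rewrite !tnormF2_unfold unfold_mode3 normF2_isometry //.
rewrite mxtens.trmx_tens mxtens.map_mxT trmx1 map_mx1 mxtens.tensmx_mul.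
by rewrite MM mul1mx tensmx1.
Qed.

Lemma mode3B {m p n q : nat} (X Y : tensor C m p n) (B : 'M[C]_(q, n)) :
  mode3 (X - Y) B = mode3 X B - mode3 Y B.
Proof.
apply/ffunP => l; apply/matrixP => i j; rewrite !ffunE !mxE -sumrB.
by apply: eq_bigr => k _; rewrite !ffunE !mxE mulrBr.
Qed.

Lemma tnormF2_starm_hat {m p n : nat} (M : 'M[C]_n) (A : tensor C m m n)
    (X Y : tensor C m p n) :
  M \is unitarymx ->
  tnormF2 (Y - starm M A X) =
  \sum_k normF2 (mode3 Y M k - mode3 A M k *m mode3 X M k).
Proof.
move=> MU; rewrite -(tnormF2_mode3 _ _ MU) mode3B.
by apply: eq_bigr => k _; rewrite -starm_hat // !ffunE.
Qed.

Lemma argmin_starm_pinv {m p n : nat} (M : 'M[C]_n) (X Y : tensor C m p n) :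
  M \is unitarymx ->
  argmin setT (fun A : tensor C m m n => tnormF2 (Y - starm M A X))
    (starm M Y (tpinv M X)).
Proof.
move=> MU; split=> // A _; rewrite !tnormF2_starm_hat //.
(* The transformed slices of the candidate are [Y_k X_k^+], so it minimizes all summands
   simultaneously. *)
apply: ler_sum => k _; rewrite starm_hat // tpinv_hat //.
exact: normF2_mp_pinv.
Qed.

End Frobenius.

Section ArgminImage.
Variables (C : numClosedFieldType) (T S : Type) (phi : T -> S).
Variables (f : T -> C) (g : S -> C).
Hypothesis fE : forall x, f x = g (phi x).

(** Every competitor in [range phi] is some [phi y] with value [f y], so both problems compare the
    same values. *)
Lemma argmin_comp (x : T) :
  argmin setT f x <-> argmin (range phi) g (phi x).
Proof.
split=> [[_ xmin]|[_ xmin]].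
  by split; [exists x | move=> _ [y _ <-]; rewrite -!fE xmin].
by split=> // y _; rewrite !fE; apply: xmin; exists y.
Qed.

Lemma argmin_range : argmin (range phi) g = phi @` argmin setT f.
Proof.
apply/seteqP; split=> [_ [[x _ <-] xmin]|_ [x xmin <-]].
  by exists x => //; apply/argmin_comp; split=> //; exists x.
exact/argmin_comp.
Qed.

Lemma minval_range : minval setT f = minval (range phi) g.
Proof.
rewrite /minval argmin_range image_comp.
by apply: eq_imagel => x _; rewrite fE.
Qed.

End ArgminImage.

(** Puts the constraint set in the form to which the transfer of minimizers along [phi] applies. *)
Lemma starm_matsE {C : numClosedFieldType} {m n : nat} (M : 'M[C]_n) :
  @starm_mats C m n M = range (starm_mat M).
Proof.
by apply/seteqP; split=> [A [Z ->]|A [Z _ <-]]; exists Z.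
Qed.

Theorem mainTheorem2 (R : realType) (m p n : nat) (M : 'M[R[i]]_n)
    (X Y : tensor R[i] m p n) (M_unitary : M \is unitarymx) :
  let f := fun A : tensor R[i] m m n => tnormF2 (Y - starm M A X) in
  let g := fun A : 'M[R[i]]_(n * m) =>
    normF2 (unfold Y - A *m unfold X) in
  let A_StarMDMD : tensor R[i] m m n := starm M Y (tpinv M X) in
  [/\ forall A : tensor R[i] m m n, f A = g (starm_mat M A),
      [/\ minval setT f = minval (starm_mats M) g,
          forall A : tensor R[i] m m n,
            argmin setT f A <-> argmin (starm_mats M) g (starm_mat M A)
        & argmin (starm_mats M) g = [set starm_mat M A | A in argmin setT f]],
      argmin setT f A_StarMDMD
    & argmin (starm_mats M) g (starm_mat M A_StarMDMD)].
Proof.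
move=> f g A_StarMDMD.
have fg A : f A = g (starm_mat M A).
  by rewrite /f /g tnormF2_unfold unfoldB unfold_starm.
have fmin : argmin setT f A_StarMDMD by exact: argmin_starm_pinv.
rewrite starm_matsE; split; [exact: fg | split | exact: fmin | ].
- exact: (minval_range _ _ _ _ _ _ fg).
- exact: (argmin_comp _ _ _ _ _ _ fg).
- exact: (argmin_range _ _ _ _ _ _ fg).
exact: (argmin_comp _ _ _ _ _ _ fg _).1.
Qed.
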